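(* For every $n\geq 4$ the commutator subgroup $A_{D_n}'$ of the Artin group $A_{D_n}$ is a finitely presented group. More precisely: (i) $A_{D_4}'$ is the group generated by $p_0=a_2a_1^{-1}$, $p_1=a_1a_2a_1^{-2}$, $q_3=a_3a_1^{-1}$, $q_4=a_4a_1^{-1}$, $b=a_2a_1^{-1}a_3a_2^{-1}$, $c=a_2a_1^{-1}a_4a_2^{-1}$, with defining relations $$b=p_0q_3p_0^{-1},\quad p_0bp_0^{-1}=b^2q_3^{-1}b,\quad p_1q_3p_1^{-1}=q_3^{-1}b,\quad p_1bp_1^{-1}=(q_3^{-1}b)^3q_3^{-2}b,$$ $$c=p_0q_4p_0^{-1},\quad p_0cp_0^{-1}=c^2q_4^{-1}c,\quad p_1q_4p_1^{-1}=q_4^{-1}c,\quad p_1cp_1^{-1}=(q_4^{-1}c)^3q_4^{-2}c,$$ $$q_3q_4=q_4q_3.$$ (ii) For $n\geq5$ the group $A_{D_n}'$ is generated by $p_0=a_2a_1^{-1}$, $p_1=a_1a_2a_1^{-2}$, $q_\ell=a_\ell a_1^{-1}$ ($3\le\ell\le n$), $b=a_2a_1^{-1}a_3a_2^{-1}$, with defining relations $$b=p_0q_3p_0^{-1},\quad p_0bp_0^{-1}=b^2q_3^{-1}b,\quad p_1q_3p_1^{-1}=q_3^{-1}b,\quad p_1bp_1^{-1}=(q_3^{-1}b)^3q_3^{-2}b,$$ $$p_0q_j=q_jp_1,\quad p_1q_j=q_jp_0^{-1}p_1\quad(4\le j\le n),$$ $$q_iq_{i+1}q_i=q_{i+1}q_iq_{i+1}\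 (3\le i\le n-2),\quad q_nq_{n-2}q_n=q_{n-2}q_nq_{n-2},$$ $$q_iq_j=q_jq_i\ (3\le i<j\le n-1,\ |i-j|\ge2),\quad q_nq_j=q_jq_n\ (3\le j\le n-1,\ j\ne n-2).$$
   Context: $A_{D_n}$ ($n\ge4$) is the Artin group of type $D_n$: generators $a_1,\dots,a_n$ and relations $a_ia_j=a_ja_i$ for $1\le i<j\le n-1$, $|i-j|\ge2$; $a_na_j=a_ja_n$ for $j\ne n-2$; $a_ia_{i+1}a_i=a_{i+1}a_ia_{i+1}$ for $1\le i\le n-2$; $a_{n-2}a_na_{n-2}=a_na_{n-2}a_n$. $G'$ denotes the commutator subgroup of $G$. ''The group is generated by the listed elements with the listed defining relations'' means that the listed elements lie in $A_{D_n}'$ and that the obvious map from the abstract group with that presentation to $A_{D_n}'$ is an isomorphism. *)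

(* Defs.v *)
From HB Require Import structures.
From mathcomp Require Import all_boot.
From mathcomp Require Import generic_quotient boolp.

Set Implicit Arguments.
Unset Strict Implicit.
Unset Printing Implicit Defensive.

Local Open Scope quotient_scope.
Local Open Scope group_scope.

(* Group words: the letter (x, false) stands for the generator x and the      *)
(* letter (x, true) for its formal inverse. Words are not freely reduced, so  *)
(* they only form a monoid with an anti-involution.                           *)
Definition word (X : Type) : Type := seq (X * bool).

Section Words.
Variable X : choiceType.

Definition word_inv (u : word X) : word X :=
  rev [seq (l.1, ~~ l.2) | l <- u].

HB.instance Definition _ := Choice.copy (word X) (seq (X * bool)).

Fact word_mulA : associative (@cat (X * bool) : word X -> word X -> word X).
Proof. exact: catA. Qed.

Fact word_mul1 :
  left_id ([::] : word X) (@cat (X * bool) : word X -> word X -> word X).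
Proof. by []. Qed.

Fact word_invK : involutive word_inv.
Proof.
move=> u; rewrite /word_inv map_rev revK -map_comp -[RHS]map_id.
by apply: eq_map => -[x b] /=; rewrite negbK.
Qed.

Fact word_invM : {morph word_inv : u v / cat u v >-> cat v u}.
Proof. by move=> u v; rewrite /word_inv map_cat rev_cat. Qed.

HB.instance Definition _ :=
  isStarMonoid.Build (word X) word_mulA word_mul1 word_invK word_invM.

Definition wgen (x : X) : word X := [:: (x, false)].

End Words.

Section Presentation.
Variables (X : choiceType) (R : word X -> word X -> Prop).

(* R u v is read as the defining relation u = v. *)
Inductive pres_eq : word X -> word X -> Prop :=
| pres_eq_rel u v : R u v -> pres_eq u v
| pres_eq_cancel u : pres_eq (u^-1 * u) 1
| pres_eq_mul u u' v v' :
    pres_eq u u' -> pres_eq v v' -> pres_eq (u * v) (u' * v')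
| pres_eq_refl u : pres_eq u u
| pres_eq_sym u v : pres_eq u v -> pres_eq v u
| pres_eq_trans u v w : pres_eq u v -> pres_eq v w -> pres_eq u w.

Definition pres_eqb (u v : word X) : bool := `[< pres_eq u v >].

Fact pres_eqb_equiv : equiv_class_of pres_eqb.
Proof.
split=> [u|u v|v u w].
- exact/asboolP/pres_eq_refl.
- by apply/asboolP/asboolP => /pres_eq_sym.
- by move=> /asboolP uv /asboolP vw; apply/asboolP; apply: pres_eq_trans uv vw.
Qed.

Canonical pres_equiv := EquivRelPack pres_eqb_equiv.

Definition presented : Type := {eq_quot pres_equiv}.

HB.instance Definition _ := Choice.copy presented {eq_quot pres_equiv}.

Definition pres_class (u : word X) : presented := \pi_{eq_quot pres_equiv} u.

Definition pgen (x : X) : presented := pres_class (wgen x).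

Definition pres_repr (x : presented) : word X :=
  @repr _ {eq_quot pres_equiv} x.

Lemma pres_classP u v : pres_class u = pres_class v <-> pres_eq u v.
Proof.
by split=> [/eqmodP/asboolP //|uv]; apply/eqmodP; apply/asboolP.
Qed.

Lemma pres_reprK : cancel pres_repr pres_class.
Proof. by move=> x; apply: reprK. Qed.

Lemma pres_repr_class u : pres_eq (pres_repr (pres_class u)) u.
Proof. by apply/pres_classP; rewrite pres_reprK. Qed.

Lemma pres_eq_inv u v : pres_eq u v -> pres_eq u^-1 v^-1.
Proof.
have cancelr w : pres_eq (w * w^-1) 1.
  by have := pres_eq_cancel w^-1; rewrite invgK.
move=> uv; apply: (pres_eq_trans (v := u^-1 * (v * v^-1))).
  rewrite -[u in pres_eq u _]mulg1; apply: pres_eq_mul (pres_eq_refl _) _.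
  exact/pres_eq_sym/cancelr.
rewrite mulgA -[v in pres_eq _ v]mul1g; apply: pres_eq_mul (pres_eq_refl _).
apply: pres_eq_trans (pres_eq_cancel u).
by apply: pres_eq_mul (pres_eq_refl _) _; apply: pres_eq_sym.
Qed.

Definition pres_mul (x y : presented) : presented :=
  pres_class (pres_repr x * pres_repr y).
Definition pres_inv (x : presented) : presented := pres_class (pres_repr x)^-1.

Lemma pres_mulE u v :
  pres_mul (pres_class u) (pres_class v) = pres_class (u * v).
Proof. by apply/pres_classP/pres_eq_mul; apply: pres_repr_class. Qed.

Lemma pres_invE u : pres_inv (pres_class u) = pres_class u^-1.
Proof. by apply/pres_classP/pres_eq_inv/pres_repr_class. Qed.

Fact pres_mulA : associative pres_mul.
Proof.
move=> x y z; rewrite -(pres_reprK x) -(pres_reprK y) -(pres_reprK z).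
by rewrite !pres_mulE mulgA.
Qed.

Fact pres_mul1 : left_id (pres_class 1) pres_mul.
Proof. by move=> x; rewrite -(pres_reprK x) pres_mulE mul1g. Qed.

Fact pres_mulr1 : right_id (pres_class 1) pres_mul.
Proof. by move=> x; rewrite -(pres_reprK x) pres_mulE mulg1. Qed.

Fact pres_mulV : left_inverse (pres_class 1) pres_inv pres_mul.
Proof.
move=> x; rewrite -(pres_reprK x) pres_invE pres_mulE.
exact/pres_classP/pres_eq_cancel.
Qed.

Fact pres_mulrV : right_inverse (pres_class 1) pres_inv pres_mul.
Proof.
move=> x; rewrite -(pres_reprK x) pres_invE pres_mulE.
by apply/pres_classP; have := pres_eq_cancel (pres_repr x)^-1; rewrite invgK.
Qed.

HB.instance Definition _ := isGroup.Build presented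
  pres_mulA pres_mul1 pres_mulr1 pres_mulV pres_mulrV.

End Presentation.

Definition finitely_presented (G : groupType) : Prop :=
  exists (k : nat) (rels : seq (word 'I_k * word 'I_k)),
  exists phi : {multiplicative presented (fun u v => (u, v) \in rels) -> G},
    bijective phi.

Section CommutatorSubgroup.
Variable G : groupType.

Inductive in_commutator : G -> Prop :=
| in_commutator_comm x y : in_commutator [~ x, y]
| in_commutator1 : in_commutator 1
| in_commutatorM x y :
    in_commutator x -> in_commutator y -> in_commutator (x * y)
| in_commutatorV x : in_commutator x -> in_commutator x^-1.

Definition commutator : pred G := fun x => `[< in_commutator x >].

Fact commutator_group_closed : group_closed commutator.
Proof.
split=> [|x y]; first exact/asboolP/in_commutator1.
move=> /asboolP Cx /asboolP Cy; apply/asboolP.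
exact/in_commutatorM/in_commutatorV.
Qed.

Definition commutator_subgroup : Type := {x : G | commutator x}.

HB.instance Definition _ := SubChoice.on commutator_subgroup.
HB.instance Definition _ := SubChoice_isSubGroup.Build
  G commutator commutator_subgroup commutator_group_closed.

End CommutatorSubgroup.

(* The commutator subgroup of G is generated by the elements f x (x : X),     *)
(* with defining relations R.                                                 *)
Definition commutator_presented_by (G : groupType) (X : choiceType)
    (R : word X -> word X -> Prop) (f : X -> G) : Prop :=
  (forall x, f x \in @commutator G) /\
  exists phi : {multiplicative presented R -> commutator_subgroup G},
    (forall x, val (phi (pgen R x)) = f x) /\ bijective phi.

Definition nat_interval (m n : nat) : Type := {i : nat | m <= i <= n}.
HB.instance Definition _ m n := Choice.on (nat_interval m n).

(* The junk value 1 for i outside of {m, ..., n} is never used below. *)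
Definition indexed_gen (m n : nat) (X : choiceType) (g : nat_interval m n -> X)
    (i : nat) : word X :=
  if insub i is Some k then wgen (g k) else 1.

Section ArtinD.
Variable n : nat.

Local Notation a := (@indexed_gen 1 n _ id).

Inductive artinD_rel : word (nat_interval 1 n) -> word (nat_interval 1 n) -> Prop :=
| artinD_comm i j : 1 <= i -> i < j -> j <= n - 1 -> 2 <= j - i ->
    artinD_rel (a i * a j) (a j * a i)
| artinD_comm_n j : 1 <= j -> j <= n - 1 -> j != n - 2 ->
    artinD_rel (a n * a j) (a j * a n)
| artinD_braid i : 1 <= i -> i <= n - 2 ->
    artinD_rel (a i * a i.+1 * a i) (a i.+1 * a i * a i.+1)
| artinD_braid_n :
    artinD_rel (a (n - 2) * a n * a (n - 2)) (a n * a (n - 2) * a n).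

Definition artinD : Type := presented artinD_rel.
HB.instance Definition _ := Group.on artinD.

Definition artinD_gen (i : nat) : artinD := pres_class artinD_rel (a i).

End ArtinD.

Inductive D4_index := D4_p0 | D4_p1 | D4_q3 | D4_q4 | D4_b | D4_c.
HB.instance Definition _ := gen_eqMixin D4_index.
HB.instance Definition _ := gen_choiceMixin D4_index.

Section D4Presentation.

Local Notation p0 := (wgen D4_p0).
Local Notation p1 := (wgen D4_p1).
Local Notation q3 := (wgen D4_q3).
Local Notation q4 := (wgen D4_q4).
Local Notation b := (wgen D4_b).
Local Notation c := (wgen D4_c).

Inductive D4_rel : word D4_index -> word D4_index -> Prop :=
| D4_rel_p0q3 : D4_rel b (p0 * q3 * p0^-1)
| D4_rel_p0b : D4_rel (p0 * b * p0^-1) (b ^+ 2 * q3^-1 * b)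
| D4_rel_p1q3 : D4_rel (p1 * q3 * p1^-1) (q3^-1 * b)
| D4_rel_p1b : D4_rel (p1 * b * p1^-1) ((q3^-1 * b) ^+ 3 * q3 ^- 2 * b)
| D4_rel_p0q4 : D4_rel c (p0 * q4 * p0^-1)
| D4_rel_p0c : D4_rel (p0 * c * p0^-1) (c ^+ 2 * q4^-1 * c)
| D4_rel_p1q4 : D4_rel (p1 * q4 * p1^-1) (q4^-1 * c)
| D4_rel_p1c : D4_rel (p1 * c * p1^-1) ((q4^-1 * c) ^+ 3 * q4 ^- 2 * c)
| D4_rel_q3q4 : D4_rel (q3 * q4) (q4 * q3).

Local Notation a := (@artinD_gen 4).

Definition D4_elt (x : D4_index) : artinD 4 :=
  match x with
  | D4_p0 => a 2 * (a 1)^-1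
  | D4_p1 => a 1 * a 2 * a 1 ^- 2
  | D4_q3 => a 3 * (a 1)^-1
  | D4_q4 => a 4 * (a 1)^-1
  | D4_b => a 2 * (a 1)^-1 * a 3 * (a 2)^-1
  | D4_c => a 2 * (a 1)^-1 * a 4 * (a 2)^-1
  end.

End D4Presentation.

Inductive D_index (n : nat) := D_p0 | D_p1 | D_q of nat_interval 3 n | D_b.
HB.instance Definition _ n := gen_eqMixin (D_index n).
HB.instance Definition _ n := gen_choiceMixin (D_index n).

Section DPresentation.
Variable n : nat.

Local Notation p0 := (wgen (D_p0 n)).
Local Notation p1 := (wgen (D_p1 n)).
Local Notation q := (indexed_gen (@D_q n)).
Local Notation b := (wgen (D_b n)).

Inductive D_rel : word (D_index n) -> word (D_index n) -> Prop :=
| D_rel_p0q3 : D_rel b (p0 * q 3 * p0^-1)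
| D_rel_p0b : D_rel (p0 * b * p0^-1) (b ^+ 2 * (q 3)^-1 * b)
| D_rel_p1q3 : D_rel (p1 * q 3 * p1^-1) ((q 3)^-1 * b)
| D_rel_p1b :
    D_rel (p1 * b * p1^-1) (((q 3)^-1 * b) ^+ 3 * q 3 ^- 2 * b)
| D_rel_p0q j : 4 <= j -> j <= n -> D_rel (p0 * q j) (q j * p1)
| D_rel_p1q j : 4 <= j -> j <= n -> D_rel (p1 * q j) (q j * p0^-1 * p1)
| D_rel_braid i : 3 <= i -> i <= n - 2 ->
    D_rel (q i * q i.+1 * q i) (q i.+1 * q i * q i.+1)
| D_rel_braid_n :
    D_rel (q n * q (n - 2) * q n) (q (n - 2) * q n * q (n - 2))
| D_rel_comm i j : 3 <= i -> i < j -> j <= n - 1 -> 2 <= j - i ->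
    D_rel (q i * q j) (q j * q i)
| D_rel_comm_n j : 3 <= j -> j <= n - 1 -> j != n - 2 ->
    D_rel (q n * q j) (q j * q n).

Local Notation a := (@artinD_gen n).

Definition D_elt (x : D_index n) : artinD n :=
  match x with
  | D_p0 => a 2 * (a 1)^-1
  | D_p1 => a 1 * a 2 * a 1 ^- 2
  | D_q l => a (val l) * (a 1)^-1
  | D_b => a 2 * (a 1)^-1 * a 3 * (a 2)^-1
  end.

End DPresentation.

(* Main.v *)
From HB Require Import structures.
From mathcomp Require Import all_boot.
From mathcomp Require Import boolp zify.
Require Import Defs.

(* Put t = a_1. Every a_i is x_i t with x_1 = 1, x_2 = p_0 and x_i = q_i for  *)
(* i >= 3, and conjugation by t maps p_0 to p_1, p_1 to p_0^-1 p_1, q_i to    *)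
(* q_i and b to q_3^-1 b. These formulas define an automorphism phi of the    *)
(* abstract group K given by the presentation, which amounts to a finite      *)
(* computation with the relations. The Artin group then acts on the set K,    *)
(* a_i acting as k |-> x_i phi(k), while the obvious morphism F : K -> A      *)
(* composed with this action is left translation; hence F is injective. Every *)
(* element of A is F(k) times a word in t, and F(K) is normalised by t, so    *)
(* F(K) contains all commutators.                                             *)

(** The presentations come from Reidemeister-Schreier rewriting with the powers of t as transversal.
    With p_k = t^k p_0 t^-k, the braid relation of a_1 and a_2 becomes p_{k+1} = p_k p_{k+2}, so p_0
    and p_1 suffice. A neighbour of a_2 gives p_k q p_{k+2} = q p_{k+1} q for all k; this infinite
    family reduces to the four relations [near], with b as auxiliary generator. A generator a_j
    commuting with a_1 and a_2 gives the two relations [far]. In type D_4 both q_3 and q_4 are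
    [near]; for n >= 5 only q_3 is.

    [near_artin] and [far_artin] show that the relations hold in A, so F exists. The [shift] and
    [unshift] lemmas show that the formulas for conjugation by t and by t^-1 respect the relations,
    so phi exists and is invertible. [near_twist] and the first [far] relation make the maps k |->
    x_i phi(k) satisfy the Artin relations. [commutator_presented_criterion] turns these facts into
    an isomorphism, and [finitely_presented_bounded] deduces finite presentability. *)

Set Implicit Arguments.
Unset Strict Implicit.
Unset Printing Implicit Defensive.

Local Open Scope group_scope.

(** * Morphisms out of a presented group *)

Section WordEval.
Variables (X : choiceType) (G : groupType) (g : X -> G).

Definition word_eval (u : word X) : G :=
  foldr (fun l z => (if l.2 then (g l.1)^-1 else g l.1) * z) 1 u.

Lemma word_eval1 : word_eval 1 = 1. Proof. by []. Qed.

Lemma word_eval_gen x : word_eval (wgen x) = g x.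
Proof. exact: mulg1. Qed.

Lemma word_evalM u v : word_eval (u * v) = word_eval u * word_eval v.
Proof.
elim: u => [|l u IH]; first exact/esym/mul1g.
by rewrite -[LHS]/(_ * word_eval ((u : word X) * v)) IH mulgA.
Qed.

Lemma word_evalV u : word_eval u^-1 = (word_eval u)^-1.
Proof.
elim: u => [|[x e] u IH]; first by rewrite -[LHS]/(1 : G) invg1.
have -> : ((x, e) :: u : word X)^-1 = (u : word X)^-1 * ([:: (x, ~~ e)] : word X).
  by rewrite -[LHS]/(rev (_ :: _)) rev_cons -cats1.
rewrite word_evalM IH /= mulg1 invgM; congr (_ * _).
by case: e; rewrite //= invgK.
Qed.

Lemma word_evalX u k : word_eval (u ^+ k) = word_eval u ^+ k.
Proof. by elim: k => // k IH; rewrite !expgS word_evalM IH. Qed.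

Lemma word_eval_indexed m n (h : nat_interval m n -> X) (s : nat -> G) i :
  (forall k, g (h k) = s (val k)) -> m <= i <= n ->
  word_eval (indexed_gen h i) = s i.
Proof.
move=> gh mni; rewrite /indexed_gen; case: insubP => [k _ <-|]; last by rewrite mni.
by rewrite word_eval_gen.
Qed.

Definition word_evalE :=
  (word_eval1, word_eval_gen, word_evalM, word_evalV, word_evalX).

End WordEval.

Section PresentedMaps.
Variables (X : choiceType) (R : word X -> word X -> Prop).

Lemma pres_classM u v : pres_class R (u * v) = pres_class R u * pres_class R v.
Proof. exact/esym/pres_mulE. Qed.

Lemma pres_classV u : pres_class R u^-1 = (pres_class R u)^-1.
Proof. exact/esym/pres_invE. Qed.

Lemma word_eval_pgen u : word_eval (pgen R) u = pres_class R u.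
Proof.
elim: u => // [[x e] u IH].
rewrite -[(x, e) :: u]/(([:: (x, e)] : word X) * (u : word X)).
rewrite word_evalM pres_classM IH; congr (_ * _).
by case: e; rewrite /= mulg1 // -pres_classV.
Qed.

Lemma pres_rel u v : R u v -> word_eval (pgen R) u = word_eval (pgen R) v.
Proof. by move=> Ruv; rewrite !word_eval_pgen; apply/pres_classP/pres_eq_rel. Qed.

Lemma pres_ind (P : presented R -> Prop) :
  P 1 -> (forall x k, P k -> P (pgen R x * k)) ->
  (forall x k, P k -> P ((pgen R x)^-1 * k)) -> forall k, P k.
Proof.
move=> P1 PM PV k; rewrite -(pres_reprK k) -word_eval_pgen.
by elim: (pres_repr k) => // -[x []] u IH; [apply: PV|apply: PM].
Qed.

Lemma pres_hom_ext (G : groupType) (f h : UMagmaMorphism.type (presented R) G) :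
  (forall x, f (pgen R x) = h (pgen R x)) -> f =1 h.
Proof.
move=> fh; elim/pres_ind=> [|x k IH|x k IH]; first by rewrite !gmulf1.
- by rewrite !gmulfM fh IH.
- by rewrite !gmulfM !gmulfV fh IH.
Qed.

Variables (G : groupType) (g : X -> G).

Lemma pres_eq_word_eval :
  (forall u v, R u v -> word_eval g u = word_eval g v) ->
  forall u v, pres_eq R u v -> word_eval g u = word_eval g v.
Proof.
move=> Rg u v; elim=> {u v} [|u|u u' v v' _ IHu _ IHv||u v _ ->|u v w _ -> _ ->] //.
- by rewrite !word_evalE mulVg.
- by rewrite !word_evalE IHu IHv.
Qed.

(** Von Dyck's theorem: evaluate any representative word; [pres_eq_word_eval] makes the choice
    irrelevant. *)
Lemma pres_lift :
  (forall u v, R u v -> word_eval g u = word_eval g v) ->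
  exists f : UMagmaMorphism.type (presented R) G, forall x, f (pgen R x) = g x.
Proof.
move=> /pres_eq_word_eval Rg.
pose f (x : presented R) := word_eval g (pres_repr x).
have fE u : f (pres_class R u) = word_eval g u by apply/Rg/pres_repr_class.
have fM : {morph f : x y / x * y}.
  move=> x y; rewrite -(pres_reprK x) -(pres_reprK y) -pres_classM !fE.
  exact: word_evalM.
have f1 : f 1 = 1 := fE 1.
pose fm : UMagmaMorphism.type (presented R) G :=
  HB.pack f (isUMagmaMorphism.Build _ _ f (f1, fM)).
by exists fm => x; rewrite -[LHS]/(f _) fE word_eval_gen.
Qed.

End PresentedMaps.

(** * Groups of bijections *)

Section Symm.
Variable T : Type.

(** The inverse map is carried as data. It is determined by the forward map, so [symm_ext] compares
    forward maps only. *)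
Definition symm : Type :=
  {s : (T -> T) * (T -> T) | cancel s.1 s.2 /\ cancel s.2 s.1}.
HB.instance Definition _ := gen_eqMixin symm.
HB.instance Definition _ := gen_choiceMixin symm.

Definition symm_fun (s : symm) : T -> T := (sval s).1.

Lemma symm_ext s t : symm_fun s =1 symm_fun t -> s = t.
Proof.
case: s t => [[f f'] [fK fK']] [[g g'] [gK gK']].
rewrite /symm_fun /= in fK fK' gK gK' * => /funext fg; subst g.
have f'g' : f' = g' by apply/funext=> x; rewrite -[x in LHS]gK' fK.
by subst g'; congr (exist _ _ _); apply: Prop_irrelevance.
Qed.

Fact symm_one_subproof : cancel (@id T) id /\ cancel (@id T) id.
Proof. by []. Qed.
Definition symm_one : symm := exist _ (id, id) symm_one_subproof.

Fact symm_mul_subproof (s t : symm) :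
  let r := ((sval s).1 \o (sval t).1, (sval t).2 \o (sval s).2) in
  cancel r.1 r.2 /\ cancel r.2 r.1.
Proof.
by case: s t => [s [sK sK']] [t [tK tK']]; split; apply: can_comp.
Qed.
Definition symm_mul s t : symm := exist _ _ (symm_mul_subproof s t).

Fact symm_inv_subproof (s : symm) :
  let r := ((sval s).2, (sval s).1) in cancel r.1 r.2 /\ cancel r.2 r.1.
Proof. by case: s => s []. Qed.
Definition symm_inv s : symm := exist _ _ (symm_inv_subproof s).

Fact symm_mulA : associative symm_mul.
Proof. by move=> s t u; apply: symm_ext. Qed.
Fact symm_mul1s : left_id symm_one symm_mul.
Proof. by move=> s; apply: symm_ext. Qed.
Fact symm_muls1 : right_id symm_one symm_mul.
Proof. by move=> s; apply: symm_ext. Qed.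
Fact symm_mulVs : left_inverse symm_one symm_inv symm_mul.
Proof. by move=> s; apply: symm_ext => x; apply: (svalP s).1. Qed.
Fact symm_mulsV : right_inverse symm_one symm_inv symm_mul.
Proof. by move=> s; apply: symm_ext => x; apply: (svalP s).2. Qed.

HB.instance Definition _ := isGroup.Build symm
  symm_mulA symm_mul1s symm_muls1 symm_mulVs symm_mulsV.

Lemma symm_funM (s t : symm) x : symm_fun (s * t) x = symm_fun s (symm_fun t x).
Proof. by []. Qed.

End Symm.

(** * The relations between p_0, p_1, q and b *)

Ltac gnf :=
  rewrite ?(expgS, expg0, invgM, invgK, invg1, mulgA, mul1g, mulg1, mulVg, mulgV,
            mulgK, mulgVK); try done.

Section Core.
Variable G : groupType.
Implicit Types p q b : G.

(** With a_2 = p_0 t, a_j = q t and q commuting with t, the first equation is a_2 a_j = a_j a_2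
    stripped of t^2; the second is its conjugate by t. *)
Definition far p0 p1 q := p0 * q = q * p1 /\ p1 * q = q * p0^-1 * p1.

Lemma far_shift p0 p1 q : far p0 p1 q -> far p1 (p0^-1 * p1) q.
Proof.
move=> [E0 E1]; split; first by rewrite E1 mulgA.
have E : p0^-1 * q = q * p1^-1.
  by apply: (mulgI p0); rewrite mulVKg mulgA E0 mulgK.
by rewrite -mulgA E1 !mulgA E; gnf.
Qed.

Lemma far_unshift p0 p1 q : far p0 p1 q -> far (p0 * p1^-1) p0 q.
Proof.
move=> [E0 E1]; split; last by rewrite E0; gnf.
have E : p1^-1 * q = q * p1^-1 * p0.
  by apply: (mulgI p1); rewrite mulVKg !mulgA E1; gnf.
by rewrite -mulgA E !mulgA E0; gnf.
Qed.

(** Since [x ^ y] is y^-1 x y, these say how conjugation by p_0 and p_1 acts on q and b. In this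
    form they serve as rewrite rules for substitution into words in q and b. *)
Definition near p0 p1 q b :=
  [/\ q ^ p0^-1 = b, b ^ p0^-1 = b ^+ 2 * q^-1 * b,
      q ^ p1^-1 = q^-1 * b & b ^ p1^-1 = (q^-1 * b) ^+ 3 * q ^- 2 * b].

Lemma nearE p0 p1 q b :
  near p0 p1 q b <->
  [/\ b = p0 * q * p0^-1, p0 * b * p0^-1 = b ^+ 2 * q^-1 * b,
      p1 * q * p1^-1 = q^-1 * b &
      p1 * b * p1^-1 = (q^-1 * b) ^+ 3 * q ^- 2 * b].
Proof.
have cE (x y : G) : x ^ y^-1 = y * x * y^-1 by rewrite conjgE invgK mulgA.
by rewrite /near !cE; split=> -[].
Qed.

(** This is a_2 a_3 a_2 = a_3 a_2 a_3 stripped of t^3. Both sides equal b p_1, because b = p_0 q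
    p_0^-1 and b = q (p_1 q p_1^-1). *)
Lemma near_twist p0 p1 q b :
  near p0 p1 q b -> p0 * q * (p0^-1 * p1) = q * p1 * q.
Proof.
by move=> /nearE[bE _ qE _]; rewrite !mulgA -bE -(mulgA q) (canRL (mulgVK _) qE); gnf.
Qed.

Lemma near_shift p0 p1 q b :
  near p0 p1 q b -> near p1 (p0^-1 * p1) q (q^-1 * b).
Proof.
move=> [E1 E2 E3 E4]; have p2E x : x ^ (p0^-1 * p1)^-1 = (x ^ p1^-1) ^ p0.
  by rewrite invgM invgK conjgM.
have bE : (q^-1 * b) ^ p1^-1 = (q^-1 * b) ^+ 2 * q ^- 2 * b.
  by rewrite conjMg conjVg E3 E4; gnf.
split=> //; rewrite ?bE ?p2E; first by gnf.
  (* No rule computes conjugation by p_0 in the direction [_ ^ p0]. Conjugating both sides back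
     leaves only the known direction. *)
  apply: (@conjg_inj _ p0^-1); rewrite conjgK E3.
  by rewrite !(conjMg, conjVg) E1 E2; gnf.
apply: (@conjg_inj _ p0^-1); rewrite conjgK bE.
by rewrite !(conjMg, conjVg, conjXg, E1, E2); gnf.
Qed.

Lemma near_unshift p0 p1 q b :
  near p0 p1 q b -> near (p0 * p1^-1) p0 q (q * b).
Proof.
move=> [E1 E2 E3 E4].
(* The shifted p_0 is p_0 p_1^-1, so conjugation by p_1 must be inverted on q and b. The two inverse
   formulas are checked by conjugating back. *)
have qE : q ^ p1 = q * b^-1 * q ^+ 3.
  apply: (@conjg_inj _ p1^-1); rewrite conjgK.
  by rewrite !(conjMg, conjVg, conjXg, E3, E4) !(expgS, expg0); gnf.
have bE : b ^ p1 = q * b^-1 * q ^+ 4.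
  apply: (@conjg_inj _ p1^-1); rewrite conjgK.
  by rewrite !(conjMg, conjVg, conjXg, E3, E4) !(expgS, expg0); gnf.
have pmE x : x ^ (p0 * p1^-1)^-1 = (x ^ p1) ^ p0^-1.
  by rewrite invgM invgK conjgM.
split; rewrite ?pmE ?(conjMg _ b) ?qE ?bE.
- by rewrite !(conjMg, conjVg, conjXg, E1, E2); gnf.
- by rewrite !(conjMg, conjVg, conjXg, E1, E2); gnf.
- by rewrite E1; gnf.
- by rewrite E1 E2; gnf.
Qed.

(* The hypotheses are the Reidemeister-Schreier relations for                 *)
(* [p k = a_1 ^+ k * p 0 * a_1 ^- k]: the braid relations of a_2 with a_1 and *)
(* with a_3, conjugated by [a_1 ^+ k].                                        *)
Lemma near_braid (p : nat -> G) q :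
  (forall k, p k.+1 = p k * p k.+2) ->
  (forall k, p k * q * p k.+2 = q * p k.+1 * q) ->
  near (p 0) (p 1%N) q (q ^ (p 0)^-1).
Proof.
move=> pS pq; set b := q ^ _.
have p2E k : p k.+2 = (p k)^-1 * p k.+1 by rewrite (pS k) mulKg.
(* Conjugating by p_k takes q to q^-k b. Together with p_{k+2} = p_k^-1 p_{k+1} this gives [down],
   whose cases k = 0 and k = 1 can be solved for the conjugates of b. *)
have qp k : q ^ (p k)^-1 = q ^- k * b.
  elim: k => [|k IH]; first by rewrite invg1 mul1g.
  rewrite expgSr invgM -mulgA -IH !conjgE !invgK; apply: (mulIg (p k.+1)).
  by apply: (mulgI q); rewrite !mulgA -pq p2E; gnf.
have down k : (q ^- k.+2 * b) ^ (p k)^-1 = q ^- k.+1 * b.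
  by rewrite -qp p2E invgM invgK conjgM conjgK -qp.
split=> //.
- have := down 0; rewrite conjMg conjVg conjXg -/b => /(canRL (mulKg _)) ->.
  by gnf.
- have := down 1%N; rewrite conjMg conjVg conjXg qp => /(canRL (mulKg _)) ->.
  by gnf.
Qed.

End Core.

(** * Injectivity and image of F *)

Section Criterion.
Variables (Y X : choiceType).
Variables (S : word Y -> word Y -> Prop) (R : word X -> word X -> Prop).

Local Notation A := (presented S).
Local Notation K := (presented R).

Variables (F : UMagmaMorphism.type K A) (phi psi : UMagmaMorphism.type K K).
Hypotheses (phiK : cancel phi psi) (psiK : cancel psi phi).

Fact twist_subproof (k : K) :
  let r := (fun l => k * phi l, fun l => psi (k^-1 * l)) in
  cancel r.1 r.2 /\ cancel r.2 r.1.
Proof. by split=> l /=; rewrite ?mulKg ?phiK // psiK mulVKg. Qed.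

(** This is the action of k t in the semidirect product of K with the infinite cyclic group
    generated by t, where K acts on itself by left translation and t acts by phi. *)
Definition twist (k : K) : symm K := exist _ _ (twist_subproof k).

Lemma symm_fun_twist k l : symm_fun (twist k) l = k * phi l.
Proof. by []. Qed.

Variables (t : Y) (x : Y -> K).
Local Notation T := (pgen S t).

Hypothesis xt : x t = 1.
Hypothesis pgenF : forall y, pgen S y = F (x y) * T.
Hypothesis Fphi_pgen : forall i, F (phi (pgen R i)) = T * F (pgen R i) * T^-1.
(** Closure under phi is included because p_1 is not a word in the x_i: it is reached as
    phi(p_0). *)
Hypothesis x_generates : forall P : K -> Prop,
  (forall y, P (x y)) -> (forall k l, P k -> P l -> P (k * l)) ->
  (forall k, P k -> P k^-1) -> (forall k, P k -> P (phi k)) ->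
  forall i, P (pgen R i).
Hypothesis twist_rel : forall u v, S u v ->
  word_eval (twist \o x) u = word_eval (twist \o x) v.
Hypothesis Fx_commutator : forall y, F (x y) \in @commutator A.

Lemma F_phi k : F (phi k) = T * F k * T^-1.
Proof.
elim/pres_ind: k => [|i k IH|i k IH].
- by rewrite !gmulf1 mulg1 mulgV.
- by rewrite !gmulfM Fphi_pgen IH; gnf.
- by rewrite !gmulfM !gmulfV Fphi_pgen IH; gnf.
Qed.

(** By [twist_rel] the group A acts on K through theta. The element F (x y) = a_y T^-1 acts as left
    translation by x y, and this property passes to products, inverses and phi-images, hence to all
    of K. Evaluating at 1 recovers k from F k. *)
Lemma F_inj : injective F.
Proof.
have [theta thetaE] := pres_lift twist_rel.
suff thetaF : forall k l, symm_fun (theta (F k)) l = k * l.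
  by move=> k l Fkl; rewrite -[k]mulg1 -[l]mulg1 -!thetaF Fkl.
have thetaV k l : (forall m, symm_fun (theta (F k)) m = k * m) ->
    symm_fun (theta (F k^-1)) l = k^-1 * l.
  by move=> kE; apply: (mulgI k); rewrite -kE -symm_funM !gmulfV mulgV mulVKg.
have thetaM k k' l : (forall m, symm_fun (theta (F k)) m = k * m) ->
    (forall m, symm_fun (theta (F k')) m = k' * m) ->
    symm_fun (theta (F (k * k'))) l = k * k' * l.
  by move=> kE k'E; rewrite !gmulfM symm_funM k'E kE mulgA.
have thetaT l : symm_fun (theta T) l = phi l.
  by rewrite thetaE /= symm_fun_twist xt mul1g.
have thetaTV l : symm_fun (theta T^-1) l = psi l.
  by rewrite -[l in LHS]psiK -thetaT -symm_funM gmulfV mulVg.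
pose P k := forall m, symm_fun (theta (F k)) m = k * m.
have theta_gen i : P (pgen R i).
  move: i; apply: x_generates => [y m|k k' kE k'E m|k kE m|k kE m].
  - have -> : F (x y) = pgen S y * T^-1 by rewrite pgenF mulgK.
    by rewrite gmulfM symm_funM thetaTV thetaE symm_fun_twist psiK.
  - exact: thetaM.
  - exact: thetaV.
  - by rewrite F_phi !gmulfM !symm_funM thetaTV kE thetaT gmulfM psiK.
elim/pres_ind=> [l|i k IH l|i k IH l].
- by rewrite !gmulf1 mul1g.
- exact: thetaM (theta_gen i) IH.
- by apply: thetaM IH => m; apply: thetaV (theta_gen i).
Qed.

Lemma F_phiV k : F (psi k) = T^-1 * F k * T.
Proof. by rewrite -{2}(psiK k) F_phi; gnf. Qed.

(* [c] is a word in [T]; the last clause makes any two such [c] commute. *)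
Lemma F_decomposition (a : A) : exists k c,
  [/\ a = F k * c, forall l, exists l', c * F l = F l' * c &
      forall d, commute d T -> commute d c].
Proof.
elim/pres_ind: a => [|y _ [k [c [-> cF cT]]]|y _ [k [c [-> cF cT]]]].
- exists 1, 1; split=> [|l|d _]; first by rewrite gmulf1 mulg1.
    by exists l; rewrite mul1g mulg1.
  exact: commute1.
- exists (x y * phi k), (T * c); split=> [|l|d dT].
  + by rewrite pgenF gmulfM F_phi; gnf.
  + have [l' l'E] := cF l; exists (phi l').
    by rewrite F_phi -mulgA l'E; gnf.
  + by apply: commuteM => //; apply: cT.
- exists (psi ((x y)^-1 * k)), (T^-1 * c); split=> [|l|d dT].
  + by rewrite pgenF F_phiV gmulfM gmulfV; gnf.
  + have [l' l'E] := cF l; exists (psi l').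
    by rewrite F_phiV -mulgA l'E; gnf.
  + by apply: commuteM; [apply: commuteV|apply: cT].
Qed.

Lemma F_onto_commutator (a : A) : in_commutator a -> exists k, F k = a.
Proof.
(* With u = a^-1 and v = b^-1 the commutator reads u v u^-1 v^-1. For u = F k * c and v = F l * d,
   moving c and d to the right leaves k l' k'^-1 l^-1, because c and d commute. *)
elim=> {a} [a b||a b _ [k <-] _ [l <-]|a _ [k <-]].
- suff [k kE] : exists k, F k = [~ a^-1^-1, b^-1^-1] by exists k; rewrite kE !invgK.
  have [k [c [-> cF cT]]] := F_decomposition a^-1.
  have [l [d [-> dF dT]]] := F_decomposition b^-1.
  have [l' l'E] := cF l; have [k' k'E] := dF k.
  have cd : c^-1 * d = d * c^-1.
    by apply/commute_sym/commuteV/commute_sym/dT/commute_sym/cT.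
  exists (k * l' * k'^-1 * l^-1).
  rewrite !gmulfM !gmulfV commgEl conjgE !invgK.
  have -> : F l' = c * F l * c^-1 by rewrite l'E mulgK.
  have -> : F k' = d * F k * d^-1 by rewrite k'E mulgK.
  by gnf; rewrite -(mulgA _ c^-1) cd; gnf.
- by exists 1; rewrite gmulf1.
- by exists (k * l); rewrite gmulfM.
- by exists k^-1; rewrite gmulfV.
Qed.

(** The commutator subgroup is normal, so the k with F k in it form a phi-stable subgroup containing
    every x y; [x_generates] then applies. *)
Lemma F_in_commutator k : F k \in @commutator A.
Proof.
have cV := group_closedV (@commutator_group_closed A).
have cM := group_closedM (@commutator_group_closed A).
have F_pgen i : F (pgen R i) \in @commutator A.
  apply: (@x_generates (fun k => F k \in @commutator A)) => [//|l m Fl Fm|l Fl|l Fl].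
  - by rewrite gmulfM; apply: cM.
  - by rewrite gmulfV; apply: cV.
  - have -> : F (phi l) = F l * [~ F l, T^-1] by rewrite F_phi commgEl conjgE; gnf.
    by apply: cM => //; apply/asboolP/in_commutator_comm.
elim/pres_ind: k => [|i k IH|i k IH].
- by rewrite gmulf1; apply/asboolP/in_commutator1.
- by rewrite gmulfM; apply: cM (F_pgen i) IH.
- by rewrite gmulfM gmulfV; apply: cM (cV _ (F_pgen i)) IH.
Qed.

Lemma commutator_presented_criterion : commutator_presented_by R (F \o pgen R).
Proof.
split=> [i|]; first exact: F_in_commutator.
pose f k : commutator_subgroup A := Sub (F k) (F_in_commutator k).
have fM : {morph f : k l / k * l} by move=> k l; apply/val_inj/gmulfM.
pose fm : {multiplicative K -> commutator_subgroup A} :=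
  HB.pack f (isMultiplicative.Build _ _ f fM).
exists fm; split=> //.
have onto (a : commutator_subgroup A) : exists k, f k = a.
  have /asboolP/F_onto_commutator [k kE] := valP a.
  by exists k; apply: val_inj.
exists (fun a => sval (cid (onto a))) => [k|a]; last exact: svalP (cid (onto a)).
by case: cid => l /= /(congr1 val); apply: F_inj.
Qed.

End Criterion.

(** * Finite presentability *)

Section Renaming.

Definition word_map (X Y : Type) (h : X -> Y) (u : word X) : word Y :=
  [seq (h l.1, l.2) | l <- u].

Lemma word_mapK (X Y : Type) (e : X -> Y) (h : Y -> X) :
  cancel e h -> cancel (word_map e) (word_map h).
Proof.
move=> eK u; rewrite /word_map -map_comp -[RHS]map_id.
by apply: eq_map => -[x c] /=; rewrite eK.
Qed.

Lemma word_eval_map (X Y : choiceType) (G : groupType) (h : X -> Y) (g : Y -> G) u :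
  word_eval g (word_map h u) = word_eval (g \o h) u.
Proof. by elim: u => //= l u ->. Qed.

Lemma presented_rename (X Y : choiceType) (R : word X -> word X -> Prop)
    (S : word Y -> word Y -> Prop) (h : Y -> X) :
  bijective h -> (forall u v, S u v <-> R (word_map h u) (word_map h v)) ->
  exists f : UMagmaMorphism.type (presented S) (presented R), bijective f.
Proof.
move=> [e hK eK] SR.
have [f fE] : exists f : UMagmaMorphism.type (presented S) (presented R),
    forall y, f (pgen S y) = pgen R (h y).
  by apply: pres_lift => u v /SR /pres_rel; rewrite !word_eval_map.
have [f' f'E] : exists f' : UMagmaMorphism.type (presented R) (presented S),
    forall x, f' (pgen R x) = pgen S (e x).
  apply: pres_lift => u v.
  rewrite -[u in R u](word_mapK eK) -[v in R _ v](word_mapK eK).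
  by move=> /SR /pres_rel; rewrite !word_eval_map.
exists f, f'.
- by apply: (@pres_hom_ext _ _ _ (f' \o f) idfun) => y /=; rewrite fE f'E hK.
- by apply: (@pres_hom_ext _ _ _ (f \o f') idfun) => x /=; rewrite f'E fE eK.
Qed.

(** Over a finite alphabet there are finitely many pairs of words of length at most N. The list of
    relations is obtained by filtering them through R. *)
Lemma finitely_presented_bounded (G : groupType) (X : choiceType)
    (R : word X -> word X -> Prop) (f : X -> G) (k N : nat) (e : X -> 'I_k) :
  bijective e -> (forall u v, R u v -> size u <= N /\ size v <= N) ->
  commutator_presented_by R f -> finitely_presented (commutator_subgroup G).
Proof.
move=> [h eK hK] Rsize [_ [phi [_ phi_bij]]].
pose W := N.-bseq ('I_k * bool)%type.
pose rels : seq (word 'I_k * word 'I_k) :=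
  [seq (val p.1, val p.2) | p <- enum {: W * W} &
     `[< R (word_map h (val p.1)) (word_map h (val p.2)) >]].
have relsP u v : (u, v) \in rels <-> R (word_map h u) (word_map h v).
  split=> [/mapP[p] | Ruv].
    by rewrite mem_filter => /andP[/asboolP Rp _] [-> ->].
  have := Rsize _ _ Ruv; rewrite !size_map => -[uN vN].
  apply/mapP; exists (Bseq uN, Bseq vN) => //.
  by rewrite mem_filter mem_enum andbT; apply/asboolP.
have h_bij : bijective h by exists e.
have [r r_bij] := presented_rename h_bij relsP.
by exists k, rels, (phi \o r); apply: bij_comp.
Qed.

End Renaming.

(** * The Artin group of type D *)

Definition braided (G : groupType) (x y : G) := x * y * x = y * x * y.

Section ArtinLemmas.
Variable G : groupType.
Implicit Types s t x y : G.

(** Braided elements are conjugate: (x y) x (x y)^-1 = y. *)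
Lemma braided_commutator x y : braided x y -> y / x \in @commutator G.
Proof.
move=> xy; suff -> : y / x = [~ (x * y)^-1, x^-1] by apply/asboolP/in_commutator_comm.
by rewrite commgEl conjgE; gnf; rewrite xy; gnf.
Qed.

Lemma commute_div t x y :
  commute t x -> commute t y -> commute x y -> commute (x / t) (y / t).
Proof.
move=> tx ty xy; have xt := commute_sym tx; have yt := commute_sym ty.
have xV : commute x (y / t) by apply: commuteM => //; apply: commuteV.
have tV : commute t (y / t) by apply: commuteM => //; apply/commuteV/commute_refl.
by apply/commute_sym/commuteM; [|apply: commuteV]; apply: commute_sym.
Qed.

Lemma braided_div t x y :
  commute t x -> commute t y -> braided x y -> braided (x / t) (y / t).
Proof.
move=> tx ty xy.
have Vt z w : commute t z -> t^-1 * (z * w) = z * (t^-1 * w).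
  by move=> /commute_sym/commuteV/commute_sym tz; rewrite !mulgA tz.
have E z w : commute t z -> commute t w ->
    z / t * (w / t) * (z / t) = z * w * z * t ^- 3.
  by move=> tz tw; rewrite -!mulgA (Vt w) // !(Vt z) //; gnf.
by rewrite /braided !E // xy.
Qed.

(** Here s, t, u stand for a_1, a_2 and a neighbour of a_2. The hypotheses of [near_braid] are
    checked at k = 0 and then conjugated by s^k, which fixes u / s. *)
Lemma near_artin s t u : braided s t -> braided t u -> commute s u ->
  near (t / s) (s * t * s ^- 2) (u / s) (t / s * u / t).
Proof.
move=> st tu su; pose p k := (t / s) ^ (s ^- k).
have p0E : p 0 = t / s by rewrite /p invg1 conjg1.
have p1E : p 1%N = s * t * s ^- 2 by rewrite /p conjgE; gnf.
have p2E : p 2 = s ^+ 2 * t * s ^- 3 by rewrite /p conjgE; gnf.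
have pD m k : p (m + k)%N = p m ^ (s ^- k).
  by rewrite /p addnC expgnDr invgM conjgM.
have qs k : (u / s) ^ (s ^- k) = u / s.
  rewrite conjgE invgK.
  suff -> : u / s * s ^- k = s ^- k * (u / s) by rewrite mulVKg.
  apply/commute_sym/commuteM.
    exact/commute_sym/commuteV/commuteX/commute_sym.
  exact/commuteV/commute_sym/commuteV/commuteX/commute_refl.
have <- : (u / s) ^ (p 0)^-1 = t / s * u / t by rewrite p0E conjgE; gnf.
have e1 : p 1%N = p 0 * p 2 by rewrite p0E p1E p2E; gnf; rewrite -st; gnf.
have uV z : z * s^-1 * u = z * u * s^-1.
  by rewrite -!mulgA (commute_sym (commuteV (commute_sym su))).
have e2 : p 0 * (u / s) * p 2 = u / s * p 1%N * (u / s).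
  by rewrite p0E p1E p2E; gnf; rewrite !uV; gnf; rewrite tu.
rewrite -p0E -p1E; apply: near_braid => k;
  rewrite (pD 0 k : p k = _) (pD 1%N k : p k.+1 = _) (pD 2 k : p k.+2 = _).
- by rewrite -conjMg e1.
- by rewrite -(qs k) -!conjMg e2.
Qed.

Lemma far_artin s t u : braided s t -> commute t u -> commute s u ->
  far (t / s) (s * t * s ^- 2) (u / s).
Proof.
move=> st tu su; have uV z : z * s^-1 * u = z * u * s^-1.
  by rewrite -!mulgA (commute_sym (commuteV (commute_sym su))).
have E z : z * t^-1 * s * t = z * s * t * s^-1.
  rewrite -!mulgA; congr (z * _); apply: (mulgI t); apply: (mulIg s).
  by gnf; rewrite -st.
split; first by gnf; rewrite uV tu.
by gnf; rewrite !uV E -(mulgA s) tu mulgA su.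
Qed.

Lemma conj_p1_artin s t : braided s t ->
  (t / s)^-1 * (s * t * s ^- 2) = s * (s * t * s ^- 2) * s^-1.
Proof.
move=> st; have E : t^-1 * (s * t) = s * t * s^-1.
  by apply: (mulgI t); apply: (mulIg s); gnf; rewrite -st.
by rewrite invgM invgK -!mulgA (mulgA s t) (mulgA t^-1) E; gnf.
Qed.

Lemma conj_q_artin s u : commute s u -> u / s = s * (u / s) * s^-1.
Proof. by move=> su; rewrite mulgA su; gnf. Qed.

(** As b = p_0 q p_0^-1 and s commutes with q, conjugation by s takes b to p_1 q p_1^-1, which is
    q^-1 b by the third [near] relation. *)
Lemma conj_b_artin s t u : braided s t -> braided t u -> commute s u ->
  (u / s)^-1 * (t / s * u / t) = s * (t / s * u / t) * s^-1.
Proof.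
move=> st tu su; have /nearE[_ _ <- _] := near_artin st tu su.
by rewrite [in LHS](conj_q_artin su); gnf.
Qed.

End ArtinLemmas.

Section ArtinSat.
Variable n : nat.

(** Indexing by all of [nat] confines subtype indices and the default value of [indexed_gen] to
    [artinD_relP]. *)
Record artinD_sat (G : groupType) (s : nat -> G) : Prop := ArtinDSat {
  artinD_sat_comm i j : 1 <= i -> i < j -> j <= n - 1 -> 2 <= j - i ->
    commute (s i) (s j);
  artinD_sat_comm_n j : 1 <= j -> j <= n - 1 -> j != n - 2 ->
    commute (s n) (s j);
  artinD_sat_braid i : 1 <= i -> i <= n - 2 -> braided (s i) (s i.+1);
  artinD_sat_braid_n : braided (s (n - 2)) (s n) }.

Hypothesis n_ge4 : 4 <= n.

Lemma artinD_relP (G : groupType) (g : nat_interval 1 n -> G) (s : nat -> G) :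
  (forall k, g k = s (val k)) ->
  (forall u v, artinD_rel u v -> word_eval g u = word_eval g v) <-> artinD_sat s.
Proof.
move=> gs; have E i : 1 <= i <= n -> word_eval g (indexed_gen id i) = s i.
  exact: word_eval_indexed.
split=> [grel|[sc scn sb sbn] u v].
  split=> [i j i1 ij jn d2|j j1 jn jn2|i i1 i2|].
  - by have := grel _ _ (artinD_comm i1 ij jn d2); rewrite !word_evalM !E //; lia.
  - by have := grel _ _ (artinD_comm_n j1 jn jn2); rewrite !word_evalM !E //; lia.
  - by have := grel _ _ (artinD_braid i1 i2); rewrite !word_evalM !E //; lia.
  - by have := grel _ _ (artinD_braid_n n); rewrite !word_evalM !E //; lia.
case=> [i j i1 ij jn d2|j j1 jn jn2|i i1 i2|]; rewrite !word_evalM !E; try lia.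
- exact: sc.
- exact: scn.
- exact: sb.
- exact: sbn.
Qed.

Local Notation a := (artinD_gen n).

Lemma artinD_genE i : a i = word_eval (pgen (@artinD_rel n)) (indexed_gen id i).
Proof. by rewrite word_eval_pgen. Qed.

Lemma pgen_artinD (k : nat_interval 1 n) : pgen (@artinD_rel n) k = a (val k).
Proof. by rewrite artinD_genE /indexed_gen valK word_eval_gen. Qed.

Lemma artinD_sat_gen : artinD_sat a.
Proof. by apply/(artinD_relP pgen_artinD) => u v; apply: pres_rel. Qed.

(** The quotient telescopes along the path 1, 2, ... of the Dynkin diagram, with node n attached to
    n - 2; each edge contributes a commutator. *)
Lemma artinD_gen_commutator i : 1 <= i <= n -> a i / a 1%N \in @commutator (artinD n).
Proof.
have [_ _ ab abn] := artinD_sat_gen.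
have cM := group_closedM (@commutator_group_closed (artinD n)).
have step k : k <= n - 2 -> a k.+1 / a 1%N \in @commutator (artinD n).
  elim: k => [_|k IH kn]; first by rewrite mulgV; apply/asboolP/in_commutator1.
  have -> : a k.+2 / a 1%N = (a k.+2 / a k.+1) * (a k.+1 / a 1%N) by gnf.
  apply: cM (IH _); last by lia.
  by apply/braided_commutator/ab; lia.
move=> i1n; have [->|inn] := eqVneq i n.
  have -> : a n / a 1%N = (a n / a (n - 2)) * (a (n - 2) / a 1%N) by gnf.
  apply: cM; first exact: braided_commutator.
  by have := step (n - 3); rewrite (_ : (n - 3).+1 = n - 2); [apply|]; lia.
by case: i i1n inn => // i i1n inn; apply: step; lia.
Qed.

End ArtinSat.

(** * Artin relations among twists *)

Section Twist.
Variables (X : choiceType) (R : word X -> word X -> Prop).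
Local Notation K := (presented R).
Variables (phi psi : UMagmaMorphism.type K K).
Hypotheses (phiK : cancel phi psi) (psiK : cancel psi phi).
Local Notation twist := (twist phiK psiK).

(** A product of two twists is left translation by k phi(l) after phi^2, so the relation reduces to
    an identity in K. [twist_braided] is the analogue with phi^3. *)
Lemma twist_commute k l : k * phi l = l * phi k -> commute (twist k) (twist l).
Proof.
move=> kl; apply: symm_ext => m.
by rewrite !symm_funM !symm_fun_twist !gmulfM !mulgA kl.
Qed.

Lemma twist_braided k l :
  k * phi l * phi (phi k) = l * phi k * phi (phi l) -> braided (twist k) (twist l).
Proof.
move=> kl; apply: symm_ext => m.
by rewrite !symm_funM !symm_fun_twist !gmulfM !mulgA kl.
Qed.

Variable n : nat.
Hypothesis n_ge4 : 4 <= n.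
Local Notation a := (artinD_gen n).
Variables (f : X -> artinD n) (F : UMagmaMorphism.type K (artinD n)) (x : nat -> K).

Lemma artinD_criterion :
  (forall i, F (pgen R i) = f i) ->
  (forall i, F (phi (pgen R i)) = a 1%N * f i * (a 1%N)^-1) ->
  x 1%N = 1 -> (forall i, 1 < i <= n -> F (x i) = a i / a 1%N) ->
  artinD_sat n (twist \o x) ->
  (forall P : K -> Prop,
     (forall i, 1 <= i <= n -> P (x i)) -> (forall k l, P k -> P l -> P (k * l)) ->
     (forall k, P k -> P k^-1) -> (forall k, P k -> P (phi k)) ->
     forall i, P (pgen R i)) ->
  commutator_presented_by R f.
Proof.
move=> Ff Fphi x1 Fx xsat xgen; have -> : f = F \o pgen R by apply/funext=> i /=.
have n1 : 1 <= 1 <= n by lia.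
pose t : nat_interval 1 n := Sub 1%N n1.
have Fx' i : 1 <= i <= n -> F (x i) = a i / a 1%N.
  case: i => [|[|i]] // iP; last by apply: Fx; lia.
  by rewrite x1 gmulf1 mulgV.
apply: (@commutator_presented_criterion _ X (@artinD_rel n) R F _ _ phiK psiK
  t (x \o val)).
- by [].
- by move=> y; rewrite !pgen_artinD /= Fx' ?mulgVK //; apply: valP y.
- by move=> i; rewrite Fphi Ff pgen_artinD.
- move=> P Px; apply: xgen => i iP.
  exact: Px (exist _ i iP).
- have xE (k : nat_interval 1 n) : (twist \o (x \o val)) k = (twist \o x) (val k) by [].
  by have [_] := artinD_relP n_ge4 xE; apply.
- by move=> y /=; rewrite Fx' ?artinD_gen_commutator //; apply: valP y.
Qed.

End Twist.

(** * The two presentations *)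

Section D4.
Local Notation K := (presented D4_rel).
Local Notation a := (artinD_gen 4).

Record D4_sat (G : groupType) (p0 p1 q3 q4 b c : G) : Prop := D4Sat {
  D4_sat_near3 : near p0 p1 q3 b;
  D4_sat_near4 : near p0 p1 q4 c;
  D4_sat_comm : commute q3 q4 }.

Lemma D4_relP (G : groupType) (g : D4_index -> G) :
  (forall u v, D4_rel u v -> word_eval g u = word_eval g v) <->
  D4_sat (g D4_p0) (g D4_p1) (g D4_q3) (g D4_q4) (g D4_b) (g D4_c).
Proof.
split=> [grel|[/nearE[E1 E2 E3 E4] /nearE[E5 E6 E7 E8] E9] u v]; last first.
  by case; rewrite !word_evalE.
split; try (apply/nearE; split).
- by have := grel _ _ D4_rel_p0q3; rewrite !word_evalE.
- by have := grel _ _ D4_rel_p0b; rewrite !word_evalE.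
- by have := grel _ _ D4_rel_p1q3; rewrite !word_evalE.
- by have := grel _ _ D4_rel_p1b; rewrite !word_evalE.
- by have := grel _ _ D4_rel_p0q4; rewrite !word_evalE.
- by have := grel _ _ D4_rel_p0c; rewrite !word_evalE.
- by have := grel _ _ D4_rel_p1q4; rewrite !word_evalE.
- by have := grel _ _ D4_rel_p1c; rewrite !word_evalE.
- by have := grel _ _ D4_rel_q3q4; rewrite !word_evalE.
Qed.

Definition D4_assign (G : Type) (p0 p1 q3 q4 b c : G) (i : D4_index) : G :=
  match i with
  | D4_p0 => p0 | D4_p1 => p1 | D4_q3 => q3 | D4_q4 => q4 | D4_b => b | D4_c => c
  end.

Lemma D4_presentation : commutator_presented_by D4_rel D4_elt.
Proof.
have [_ _ ab ab4] := artinD_sat_gen (leqnn 4).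
have ac := artinD_sat_comm (artinD_sat_gen (leqnn 4)).
have ac4 := artinD_sat_comm_n (artinD_sat_gen (leqnn 4)).
have a12 : braided (a 1%N) (a 2) by apply: ab.
have a23 : braided (a 2) (a 3) by apply: ab.
have a24 : braided (a 2) (a 4) by apply: ab4.
have a13 : commute (a 1%N) (a 3) by apply: ac.
have a14 : commute (a 1%N) (a 4) by apply/commute_sym/ac4.
have a34 : commute (a 3) (a 4) by apply/commute_sym/ac4.
have [F FE] : exists F : UMagmaMorphism.type K (artinD 4),
    forall i, F (pgen D4_rel i) = D4_elt i.
  apply/pres_lift/D4_relP; split; [exact: near_artin|exact: near_artin|].
  exact: commute_div.
pose g i := pgen D4_rel i.
have [n3 n4 q34] : D4_sat (g D4_p0) (g D4_p1) (g D4_q3) (g D4_q4) (g D4_b) (g D4_c).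
  by apply/D4_relP => u v; apply: pres_rel.
have [phi phiE] : exists phi : UMagmaMorphism.type K K, forall i, phi (g i) =
    D4_assign (g D4_p1) ((g D4_p0)^-1 * g D4_p1) (g D4_q3) (g D4_q4)
      ((g D4_q3)^-1 * g D4_b) ((g D4_q4)^-1 * g D4_c) i.
  by apply/pres_lift/D4_relP; split=> //; apply: near_shift.
have [psi psiE] : exists psi : UMagmaMorphism.type K K, forall i, psi (g i) =
    D4_assign (g D4_p0 * (g D4_p1)^-1) (g D4_p0) (g D4_q3) (g D4_q4)
      (g D4_q3 * g D4_b) (g D4_q4 * g D4_c) i.
  by apply/pres_lift/D4_relP; split=> //; apply: near_unshift.
have phiK : cancel phi psi.
  apply: (@pres_hom_ext _ _ _ (psi \o phi) idfun) => i /=; rewrite phiE.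
  by case: i => /=; rewrite ?gmulfM ?gmulfV !psiE /=; gnf.
have psiK : cancel psi phi.
  apply: (@pres_hom_ext _ _ _ (phi \o psi) idfun) => i /=; rewrite psiE.
  by case: i => /=; rewrite ?gmulfM ?gmulfV !phiE /=; gnf.
(* The default branch supplies x_1 = 1, as a_1 = t; the other indices it covers lie outside the
   range 1 to 4. *)
pose x i := match i with 2 => g D4_p0 | 3 => g D4_q3 | 4 => g D4_q4 | _ => 1 end.
apply: (artinD_criterion (leqnn 4) (phiK := phiK) (psiK := psiK) (x := x) FE) => //.
- move=> i; rewrite phiE; case: i; rewrite /= ?gmulfM ?gmulfV !FE /=.
  + by gnf.
  + exact: conj_p1_artin.
  + exact: conj_q_artin.
  + exact: conj_q_artin.
  + exact: conj_b_artin.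
  + exact: conj_b_artin.
- by case=> [|[|[|[|[|i]]]]] //= _; rewrite FE.
- split=> [i j i1 ij jn d2|j j1 jn jn2|i i1 i2|].
  + have -> : i = 1%N by lia.
    have -> : j = 3 by lia.
    by apply: twist_commute; rewrite /= phiE /= gmulf1 mulg1 mul1g.
  + have [->|->] : j = 1%N \/ j = 3 by lia.
      by apply: twist_commute; rewrite /= phiE /= gmulf1 mulg1 mul1g.
    by apply: twist_commute; rewrite /= !phiE.
  + have [->|->] : i = 1%N \/ i = 2 by lia.
      apply: twist_braided.
      by rewrite /= !gmulf1 !(phiE, mul1g, mulg1) /= ?phiE /=; gnf.
    by apply: twist_braided; rewrite /= !phiE /= ?phiE /=; apply: near_twist n3.
  + by apply: twist_braided; rewrite /= !phiE /= ?phiE /=; apply: near_twist n4.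
(* The generators that are not some x_i are p_1 = phi(p_0), b = p_0 q_3 p_0^-1 and c = p_0 q_4
   p_0^-1. *)
- move=> P Px PM PV Pphi.
  have P0 : P (g D4_p0) by apply: (Px 2).
  have P3 : P (g D4_q3) by apply: (Px 3).
  have P4 : P (g D4_q4) by apply: (Px 4).
  have E3 := (nearE _ _ _ _).1 n3; have E4 := (nearE _ _ _ _).1 n4.
  case; rewrite -/(g _) //.
  + by have := Pphi _ P0; rewrite phiE.
  + by have [-> _ _ _] := E3; apply: (PM _ _ (PM _ _ P0 P3)); apply: PV.
  + by have [-> _ _ _] := E4; apply: (PM _ _ (PM _ _ P0 P4)); apply: PV.
Qed.

End D4.

Section D.
Variable n : nat.
Hypothesis n_ge5 : 5 <= n.
Local Notation K := (presented (@D_rel n)).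
Local Notation a := (artinD_gen n).

Definition D_assign (G : Type) (p0 p1 : G) (q : nat -> G) (b : G) (i : D_index n) : G :=
  match i with D_p0 => p0 | D_p1 => p1 | D_q l => q (val l) | D_b => b end.

Record D_sat (G : groupType) (p0 p1 : G) (q : nat -> G) (b : G) : Prop := DSat {
  D_sat_near : near p0 p1 (q 3) b;
  D_sat_far j : 4 <= j -> j <= n -> far p0 p1 (q j);
  D_sat_braid i : 3 <= i -> i <= n - 2 -> braided (q i) (q i.+1);
  D_sat_braid_n : braided (q n) (q (n - 2));
  D_sat_comm i j : 3 <= i -> i < j -> j <= n - 1 -> 2 <= j - i ->
    commute (q i) (q j);
  D_sat_comm_n j : 3 <= j -> j <= n - 1 -> j != n - 2 -> commute (q n) (q j) }.

Lemma D_relP (G : groupType) (p0 p1 : G) q b (g := D_assign p0 p1 q b) :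
  (forall u v, D_rel u v -> word_eval g u = word_eval g v) <-> D_sat p0 p1 q b.
Proof.
have E i : 3 <= i <= n -> word_eval g (indexed_gen (@D_q n) i) = q i.
  exact: word_eval_indexed.
split=> [grel|[/nearE[E1 E2 E3 E4] qf qb qbn qc qcn] u v].
  split=> [|j j4 jn|i i3 i2||i j i3 ij jn d2|j j3 jn jn2].
  - apply/nearE; split.
    + by have := grel _ _ (@D_rel_p0q3 n); rewrite !word_evalE E //; lia.
    + by have := grel _ _ (@D_rel_p0b n); rewrite !word_evalE E //; lia.
    + by have := grel _ _ (@D_rel_p1q3 n); rewrite !word_evalE E //; lia.
    + by have := grel _ _ (@D_rel_p1b n); rewrite !word_evalE E //; lia.
  - split.
    + by have := grel _ _ (D_rel_p0q j4 jn); rewrite !word_evalE E //; lia.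
    + by have := grel _ _ (D_rel_p1q j4 jn); rewrite !word_evalE E //; lia.
  - by have := grel _ _ (D_rel_braid i3 i2); rewrite !word_evalM !E //; lia.
  - by have := grel _ _ (D_rel_braid_n n); rewrite !word_evalM !E //; lia.
  - by have := grel _ _ (D_rel_comm i3 ij jn d2); rewrite !word_evalM !E //; lia.
  - by have := grel _ _ (D_rel_comm_n j3 jn jn2); rewrite !word_evalM !E //; lia.
case=> [||||j j4 jn|j j4 jn|i i3 i2||i j i3 ij jn d2|j j3 jn jn2];
  rewrite !word_evalE ?E //; try lia.
- by case: (qf j j4 jn).
- by case: (qf j j4 jn).
- exact: qb.
- exact: qc.
- exact: qcn.
Qed.

Lemma D_presentation : commutator_presented_by (@D_rel n) (@D_elt n).
Proof.
have n_ge4 : 4 <= n by lia.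
have [ac acn ab abn] := artinD_sat_gen n_ge4.
have a1j j : 3 <= j -> j <= n -> commute (a 1%N) (a j).
  move=> j3 jn; have [->|jn'] := eqVneq j n; last by apply: ac; lia.
  by apply/commute_sym/acn; lia.
have a2j j : 4 <= j -> j <= n -> commute (a 2) (a j).
  move=> j3 jn; have [->|jn'] := eqVneq j n; last by apply: ac; lia.
  by apply/commute_sym/acn; lia.
have a12 : braided (a 1%N) (a 2) by apply: ab; lia.
have a23 : braided (a 2) (a 3) by apply: ab; lia.
have eltE : @D_elt n = D_assign (a 2 / a 1%N) (a 1%N * a 2 * a 1%N ^- 2)
    (fun j => a j / a 1%N) (a 2 / a 1%N * a 3 / a 2).
  by apply/funext; case.
have [F FE] : exists F : UMagmaMorphism.type K (artinD n),
    forall i, F (pgen (@D_rel n) i) = @D_elt n i.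
  rewrite eltE; apply/pres_lift/D_relP.
  split=> [|j j4 jn|i i3 i2||i j i3 ij jn d2|j j3 jn jn2].
  - by apply: near_artin => //; apply: a1j; lia.
  - by apply: far_artin; [|apply: a2j|apply: a1j]; rewrite // ltnW.
  - by apply: braided_div; [apply: a1j|apply: a1j|apply: ab]; lia.
  - by apply: braided_div; [apply: a1j|apply: a1j|exact: esym abn]; lia.
  - by apply: commute_div; [apply: a1j|apply: a1j|apply: ac]; lia.
  - by apply: commute_div; [apply: a1j|apply: a1j|apply: acn]; lia.
pose g i := pgen (@D_rel n) i.
(* This extends the q_l to all natural indices, with value 1 outside 3, ..., n, as [D_sat]
   requires. *)
pose q j := word_eval g (indexed_gen (@D_q n) j).
have gq l : g (D_q l) = q (val l) by rewrite /q /indexed_gen valK word_eval_gen.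
have gE : g = D_assign (g (D_p0 n)) (g (D_p1 n)) q (g (D_b n)).
  by apply/funext; case.
set p0 := g (D_p0 n) in gE; set p1 := g (D_p1 n) in gE; set b := g (D_b n) in gE.
have sat : D_sat p0 p1 q b by apply/D_relP => u v; rewrite -gE; apply: pres_rel.
have [qn qf qb qbn qc qcn] := sat.
have [phi phiE] : exists phi : UMagmaMorphism.type K K, forall i, phi (g i) =
    D_assign p1 (p0^-1 * p1) q ((q 3)^-1 * b) i.
  apply/pres_lift/D_relP; split=> // [|j j4 jn]; first exact: near_shift.
  exact/far_shift/qf.
have [psi psiE] : exists psi : UMagmaMorphism.type K K, forall i, psi (g i) =
    D_assign (p0 * p1^-1) p0 q (q 3 * b) i.
  apply/pres_lift/D_relP; split=> // [|j j4 jn]; first exact: near_unshift.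
  exact/far_unshift/qf.
have qg j : 3 <= j -> j <= n ->
    exists l : nat_interval 3 n, q j = g (D_q l) /\ val l = j.
  move=> j3 jn; have jP : 3 <= j <= n by rewrite j3.
  by exists (exist _ j jP); rewrite gq.
have phiq j : 3 <= j -> j <= n -> phi (q j) = q j.
  by move=> j3 jn; have [l [-> _]] := qg j j3 jn; rewrite phiE /= gq.
have psiq j : 3 <= j -> j <= n -> psi (q j) = q j.
  by move=> j3 jn; have [l [-> _]] := qg j j3 jn; rewrite psiE /= gq.
have Fq j : 3 <= j -> j <= n -> F (q j) = a j / a 1%N.
  by move=> j3 jn; have [l [-> <-]] := qg j j3 jn; rewrite FE.
have n3 : 3 <= n by lia.
have phip0 : phi p0 = p1 by apply: phiE.
have phip1 : phi p1 = p0^-1 * p1 by apply: phiE.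
have phiK : cancel phi psi.
  apply: (@pres_hom_ext _ _ _ (psi \o phi) idfun) => i /=; rewrite phiE.
  have [[p0E p1E] bE] := (psiE (D_p0 n), psiE (D_p1 n), psiE (D_b n)).
  case: i => [||l|] /=; last by rewrite !gmulfM !gmulfV bE psiq //=; gnf.
  - by rewrite p1E.
  - by rewrite gmulfM gmulfV p0E p1E /=; gnf.
  - by have /andP[l3 ln] := valP l; rewrite psiq // -gq.
have psiK : cancel psi phi.
  apply: (@pres_hom_ext _ _ _ (phi \o psi) idfun) => i /=; rewrite psiE.
  have bE := phiE (D_b n).
  case: i => [||l|] /=; last by rewrite gmulfM bE phiq //=; gnf.
  - by rewrite gmulfM gmulfV phip0 phip1; gnf.
  - by rewrite phip0.
  - by have /andP[l3 ln] := valP l; rewrite phiq // -gq.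
pose x i := match i with 1 => 1 | 2 => p0 | _ => q i end.
have xE i : 3 <= i -> x i = q i by case: i => [|[|[|i]]].
have x1 i : 3 <= i -> i <= n -> x 1%N * phi (x i) = x i * phi (x 1%N).
  by move=> i3 iN; rewrite (xE i) // -[x 1%N]/(1 : K) gmulf1 mulg1 mul1g phiq.
have x2 i : 4 <= i -> i <= n -> x 2 * phi (x i) = x i * phi (x 2).
  move=> i4 iN; have i3 := ltnW i4; rewrite (xE i) // -[x 2]/p0 phip0 phiq //.
  by case: (qf i i4 iN).
apply: (artinD_criterion n_ge4 (phiK := phiK) (psiK := psiK) (x := x) FE) => //.
- move=> i; rewrite phiE; case: i => [||l|]; rewrite /= ?gmulfM ?gmulfV.
  + by rewrite FE /=; gnf.
  + by rewrite !FE; apply: conj_p1_artin.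
  + by case/andP: (valP l) => l3 ln; rewrite Fq //; apply/conj_q_artin/a1j.
  + by rewrite FE Fq //; apply: conj_b_artin => //; apply: a1j.
- move=> i; case: (leqP 3 i) => [i3|i2] iP; first by rewrite xE // Fq //; lia.
  have -> : i = 2 by lia.
  exact: FE.
(* The commutation with a_n is flipped so that the smaller index comes first and [x1] and [x2] apply
   to both kinds of commutation. *)
- split=> [i j i1 ij jn d2|j j1 jn jn2|i i1 i2|]; [apply: twist_commute
    |apply/commute_sym/twist_commute|apply: twist_braided|apply: twist_braided].
  + case: (leqP 3 i) => [i3|i3].
      by rewrite !xE ?phiq; try lia; apply: qc.
    have [iE|iE] : i = 1%N \/ i = 2 by lia.
      by rewrite iE; apply: x1; lia.
    by rewrite iE; apply: x2; lia.
  + case: (leqP 3 j) => [j3|j3].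
      by rewrite !xE ?phiq; try lia; apply/commute_sym/qcn.
    have [->|->] : j = 1%N \/ j = 2 by lia.
      by apply: x1; lia.
    by apply: x2; lia.
  + case: (leqP 3 i) => [i3|i3].
      by rewrite !xE ?phiq ?phiq; try lia; apply: qb.
    have [->|->] : i = 1%N \/ i = 2 by lia.
      by rewrite /= !gmulf1 phip0 phip1; gnf.
    by rewrite /= phip0 phip1 !phiq //; apply: near_twist qn.
  + by rewrite !xE ?phiq ?phiq; try lia; apply: esym qbn.
- move=> P Px PM PV Pphi.
  have P0 : P p0 by apply: (Px 2); lia.
  have Pq i : 3 <= i -> i <= n -> P (q i).
    by move=> i3 iN; rewrite -xE //; apply: Px; lia.
  have [bE _ _ _] := (nearE _ _ _ _).1 qn.
  case=> [||l|]; rewrite -/(g _) //.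
  + by rewrite -[g _]phip0; apply: Pphi.
  + by rewrite gq; case/andP: (valP l) => l3 ln; apply: Pq.
  + by rewrite -[g _]/b bE; apply: (PM _ _ (PM _ _ P0 _)); [apply: Pq|apply: PV].
Qed.

End D.

(** * Numbering the generators, and the theorem *)

Definition D4_code (i : D4_index) : 'I_6 :=
  match i with
  | D4_p0 => inord 0 | D4_p1 => inord 1 | D4_q3 => inord 2
  | D4_q4 => inord 3 | D4_b => inord 4 | D4_c => inord 5
  end.

Definition D4_decode (i : 'I_6) : D4_index :=
  match val i with
  | 0 => D4_p0 | 1 => D4_p1 | 2 => D4_q3 | 3 => D4_q4 | 4 => D4_b | _ => D4_c
  end.

Lemma D4_code_bij : bijective D4_code.
Proof.
exists D4_decode => [[]|[i i6]]; rewrite /D4_decode /= ?inordK //.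
by apply/val_inj; case: i i6 => [|[|[|[|[|[|i]]]]]] //= i6; rewrite inordK.
Qed.

(** Each q_l is coded by l itself, from 3 to n, which leaves exactly 0, 1 and 2 for p_0, p_1 and
    b. *)
Definition D_code n (i : D_index n) : 'I_n.+1 :=
  match i with
  | D_p0 => inord 0 | D_p1 => inord 1 | D_b => inord 2 | D_q l => inord (val l)
  end.

Definition D_decode n (i : 'I_n.+1) : D_index n :=
  match val i with
  | 0 => D_p0 n | 1 => D_p1 n | 2 => D_b n
  | k => if insub k is Some l then D_q l else D_p0 n
  end.

Lemma D_code_bij n : 5 <= n -> bijective (@D_code n).
Proof.
move=> n5; exists (@D_decode n) => [[||[k kP]|]|[k kn]]; rewrite /D_decode /=.
- by rewrite inordK.
- by rewrite inordK //; lia.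
- rewrite inordK ?ltnS; last by case/andP: kP.
  by case: k kP => [|[|[|k]]] // kP; rewrite insubT //=.
- by rewrite inordK //; lia.
- apply: val_inj; case: k kn => [|[|[|k]]] kn /=; rewrite ?inordK //; try lia.
  by rewrite insubT /= inordK.
Qed.

Theorem theorem3p11 :
  (forall n : nat, 4 <= n ->
     finitely_presented (commutator_subgroup (artinD n))) /\
  commutator_presented_by D4_rel D4_elt /\
  (forall n : nat, 5 <= n ->
     commutator_presented_by (@D_rel n) (@D_elt n)).
Proof.
split; last by split; [apply: D4_presentation|apply: D_presentation].
move=> n; rewrite leq_eqVlt => /orP[/eqP <-|n5].
  (* The bound 20 is generous: the longest side of a relation, (q_3^-1 b)^3 q_3^-2 b, has 9
     letters. *)
  apply: (finitely_presented_bounded (N := 20) D4_code_bij _ D4_presentation).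
  by move=> u v; case.
apply: (finitely_presented_bounded (N := 20) (D_code_bij n5) _ (D_presentation n5)).
(* Each [q i] is one letter, or the empty word when [insub] fails; the length bound is computed in
   either case. *)
by move=> u v; case=> *; rewrite /indexed_gen; do ?case: (insub _) => [?|].
Qed.
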